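(* Let $1\le m\le n$ be integers, let $B\in\mathbb{R}^{m\times n}$ be a (deterministic) matrix, and let $X_{m,n}$ be a random real $m\times n$ matrix whose entries are independent, identically distributed symmetric random variables with variance $1$ and all moments finite. For $\theta\ge 0$ let $$f_\theta(x)=\mathbb{E}\left\{\det\left[xI_m-(B+\sqrt{\theta}X_{m,n})(B+\sqrt{\theta}X_{m,n})^{\intercal}\right]\right\}.$$ Let $J\subseteq[0,\infty)$ be an interval of positive length and let $\lambda_1,\dots,\lambda_m$ be differentiable functions on $J$ (one-sided at endpoints belonging to $J$) such that for every $\theta\in J$ the numbers $\lambda_1(\theta),\dots,\lambda_m(\theta)$ are distinct and $f_\theta(x)=\prod_{i=1}^m(x-\lambda_i(\theta))$. Then for every $i$ and every $\theta\in J$, $$\frac{\partial\lambda_i}{\partial\theta}=n+\sum_{j\neq i}\frac{\lambda_i+\lambda_j}{\lambda_i-\lambda_j}.$$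
   Context: A random variable $Y$ is symmetric if $Y$ and $-Y$ have the same distribution. $M^{\intercal}$ denotes the transpose of $M$. *)

(* Defs.v *)
From HB Require Import structures.
From mathcomp Require Import all_boot all_order all_algebra.
From mathcomp Require Import all_classical all_reals all_analysis.
Import Order.TTheory GRing.Theory Num.Theory.
Import numFieldNormedType.Exports.

Set Implicit Arguments.
Unset Strict Implicit.
Unset Printing Implicit Defensive.

Local Open Scope classical_set_scope.
Local Open Scope ring_scope.

Section RandomVariables.
Context {d : measure_display} {T : measurableType d} {R : realType}.
Variable P : probability T R.

(* [pushforward P X] is the body of [distribution P X]; it is used directly so
   that [- X] need not be packed as a random variable.  Laws are compared on
   measurable sets only: the values of [P] elsewhere are not constrained. *)
Definition same_distribution (X Y : T -> R) : Prop :=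
  forall A : set R, measurable A -> pushforward P X A = pushforward P Y A.

Definition symmetric_RV (X : {RV P >-> R}) : Prop :=
  same_distribution X (fun w => - X w).

Definition all_moments_finite (X : {RV P >-> R}) : Prop :=
  forall k : nat, ('E_P[fun w => (`|X w| ^+ k)%R] < +oo)%E.

Definition mutually_independent (I : finType) (X : I -> {RV P >-> R}) : Prop :=
  forall (S : {set I}) (A : I -> set R),
    (forall i, measurable (A i)) ->
    P (\bigcap_(i in [set` S]) (X i @^-1` A i)) =
    (\prod_(i in S) P (X i @^-1` A i))%E.

Definition random_matrix (m n : nat) (X : 'I_m -> 'I_n -> {RV P >-> R})
  (w : T) : 'M[R]_(m, n) := \matrix_(i, j) X i j w.

Definition expected_charpoly (m n : nat) (B : 'M[R]_(m, n))
    (X : 'I_m -> 'I_n -> {RV P >-> R}) (theta x : R) : \bar R :=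
  let M w := B + Num.sqrt theta *: random_matrix X w in
  ('E_P[fun w => (\det (x%:M - M w *m (M w)^T))%R])%E.

End RandomVariables.

(* Derivative relative to [J]: [t] tends to [a] with [t \in J] and [t != a], so
   it is the usual derivative in the interior of an interval [J] and the
   one-sided derivative at an endpoint belonging to [J]. *)
Section RelativeDerivative.
Context {R : realType}.

Definition derivable_within (J : set R) (f : R -> R) (a : R) : Prop :=
  cvg ((fun t : R => (f t - f a) / (t - a)) @ within J a^').

Definition derive_within (J : set R) (f : R -> R) (a : R) : R :=
  lim ((fun t : R => (f t - f a) / (t - a)) @ within J a^').

End RelativeDerivative.

(* Main.v *)
Require Import Defs.
From HB Require Import structures.
From mathcomp Require Import all_boot all_order fingroup perm all_algebra.
From mathcomp Require Import all_classical all_reals all_analysis.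
From mathcomp Require Import measurable_realfun.
From mathcomp Require Import ring lra zify.
Import Order.TTheory GRing.Theory Num.Theory.
Import numFieldNormedType.Exports.
Local Open Scope ring_scope.

(** det(x I - M M^T) is the determinant of the block matrix (xI, M; M^T, I).  In
its Leibniz expansion a permutation s contributes only if it moves no index
within its own block, and then contributes a power of x times a monomial of
degree at most 2 in each entry of M, with degree 2 in M_ij exactly when s swaps
row i with row m + j.  Hence the mean of the determinant depends on the entries
of X only through E X = 0 and E X^2 = 1, and it is a polynomial in x and theta.
Differentiating in theta selects, for each (i, j), the permutations swapping i
and m + j; composing with that transposition changes the sign and gives the
permutations fixing both.  As a contributing permutation fixes n - m more
indices in the second block than in the first, this is the heat-type equation
  d_theta f = - ((n - m + 1) f' + x f'').
Differentiating f_theta(a) = prod_j (a - lambda_j(theta)) at fixed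
a = lambda_i(theta_0) then gives the formula. *)

Set Implicit Arguments.
Unset Strict Implicit.
Unset Printing Implicit Defensive.

(** * The Leibniz expansion and its heat equation *)

Lemma prod_natr_forall (R : comNzRingType) (I : finType) (a : pred I) :
  \prod_i (a i)%:R = [forall i, a i]%:R :> R.
Proof.
have [/forallP aT|/forallPn[i /negPf ai]] := boolP [forall i, a i].
  by rewrite big1// => i _; rewrite aT.
by rewrite (bigD1 i)//= ai mul0r.
Qed.

Lemma deriv_prod (R : comNzRingType) (I : finType) (F : I -> {poly R}) :
  (\prod_i F i)^`() = \sum_i (F i)^`() * \prod_(j | j != i) F j.
Proof.
have : uniq (index_enum I) by exact: index_enum_uniq.
elim: (index_enum I) => [_|k r IH /= /andP[kr ur]].
  by rewrite !big_nil derivC.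
rewrite !big_cons derivM IH// eqxx/=; congr (_ + _).
  congr (_ * _); rewrite big_seq [RHS]big_seq_cond; apply: eq_bigl => j.
  have [jr|//] := boolP (j \in r).
  by apply/esym; apply: contraNneq kr => <-.
rewrite mulr_sumr big_seq [RHS]big_seq; apply: eq_bigr => i ir.
have ki : k != i by apply: contraNneq kr => ->.
by rewrite big_cons ki; exact: mulrCA.
Qed.

Section BipartitePermutations.
Variables m n : nat.
Implicit Types (s : 'S_(m + n)) (i : 'I_m) (j : 'I_n).

Definition fixl s := #|[set i | s (lshift n i) == lshift n i]|.
Definition fixr s := #|[set j | s (rshift m j) == rshift m j]|.

(* The degree of M_ij in the Leibniz term of s. *)
Definition mult s i j : nat :=
  (s (lshift n i) == rshift m j) + (s (rshift m j) == lshift n i).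

(** An index sent into its own block must be a fixed point: the diagonal blocks of the saddle matrix
    are scalar, so every other permutation contributes zero. *)
Definition admissible s : bool :=
  [forall i, forall i', (s (lshift n i) == lshift n i') ==> (i == i')] &&
  [forall j, forall j', (s (rshift m j) == rshift m j') ==> (j == j')].

(** Schur complement: left multiplication by the unipotent block matrix (1, -M; 0, 1) clears the
    upper right block and leaves x - M M^T and 1 on the diagonal. *)
Lemma det_saddle (R : comNzRingType) (M : 'M[R]_(m, n)) (x : R) :
  \det (x%:M - M *m M^T) = \det (block_mx x%:M M M^T 1%:M).
Proof.
have <- : \det (block_mx 1%:M (- M) 0 1%:M *m block_mx x%:M M M^T 1%:M)
        = \det (block_mx x%:M M M^T 1%:M).
  by rewrite det_mulmx det_ublock !det1 !mul1r.
rewrite mulmx_block !mul1mx !mul0mx mulmx1 mulNmx subrr !add0r.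
by rewrite det_lblock det1 mulr1.
Qed.

(** The entry is written as an indicator times powers with exponents 0 or 1, so that multiplying
    over the rows only adds exponents. *)
Lemma saddle_lrow (R : comNzRingType) (M : 'M[R]_(m, n)) (x : R) i (r : 'I_(m + n)) :
  block_mx x%:M M M^T 1%:M (lshift n i) r =
  ([forall i', (r == lshift n i') ==> (i == i')]%:R * x ^+ (r == lshift n i)) *
  \prod_j M i j ^+ (r == rshift m j).
Proof.
case: (split_ordP r) => k ->.
  rewrite block_mxEul mxE big1 ?mulr1; last by move=> j _; rewrite eq_lrshift.
  rewrite eq_lshift [k == i]eq_sym; have [<-|ik] := eqVneq i k.
    rewrite mulr1n (_ : [forall _, _]) ?mul1r//.
    by apply/forallP => i'; rewrite eq_lshift implybb.
  rewrite mulr0n (_ : [forall _, _] = false) ?mul0r//.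
  by apply/forallP => /(_ k); rewrite eqxx (negPf ik).
rewrite block_mxEur (bigD1 k)//= eqxx expr1 big1 => [|j jk]; last first.
  by rewrite eq_rshift eq_sym (negPf jk).
rewrite eq_rlshift mulr1 mulr1 (_ : [forall _, _]) ?mul1r//.
by apply/forallP => i'; rewrite eq_rlshift.
Qed.

Lemma saddle_rrow (R : comNzRingType) (M : 'M[R]_(m, n)) (x : R) j (r : 'I_(m + n)) :
  block_mx x%:M M M^T 1%:M (rshift m j) r =
  [forall j', (r == rshift m j') ==> (j == j')]%:R *
  \prod_i M i j ^+ (r == lshift n i).
Proof.
case: (split_ordP r) => k ->.
  rewrite block_mxEdl mxE (bigD1 k)//= eqxx expr1 big1 => [|i ik]; last first.
    by rewrite eq_lshift eq_sym (negPf ik).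
  rewrite mulr1 (_ : [forall _, _]) ?mul1r//.
  by apply/forallP => i'; rewrite eq_lrshift.
rewrite block_mxEdr mxE big1 ?mulr1; last by move=> i _; rewrite eq_rlshift.
have [<-|jk] := eqVneq j k.
  rewrite (_ : [forall _, _])//.
  by apply/forallP => i'; rewrite eq_rshift implybb.
rewrite (_ : [forall _, _] = false)//.
by apply/forallP => /(_ k); rewrite eqxx (negPf jk).
Qed.

Lemma charpoly_gram_expansion (R : comNzRingType) (M : 'M[R]_(m, n)) (x : R) :
  \det (x%:M - M *m M^T) =
  \sum_(s | admissible s) (-1) ^+ s * x ^+ fixl s *
     \prod_(e : 'I_m * 'I_n) M e.1 e.2 ^+ mult s e.1 e.2.
Proof.
rewrite det_saddle /determinant [RHS]big_mkcond; apply: eq_bigr => s _.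
rewrite big_split_ord/=.
under eq_bigr do rewrite saddle_lrow.
under [X in _ * (_ * X)]eq_bigr do rewrite saddle_rrow.
rewrite !big_split/= !prod_natr_forall.
have -> : \prod_i x ^+ (s (lshift n i) == lshift n i) = x ^+ fixl s.
  rewrite prodrXr; congr (_ ^+ _); rewrite /fixl -sum1_card [RHS]big_mkcond/=.
  by apply: eq_bigr => i _; rewrite inE; case: eqP.
rewrite -(pair_bigA _ (fun i j => M i j ^+ mult s i j))/=.
have -> : \prod_i \prod_j M i j ^+ mult s i j =
   (\prod_i \prod_j M i j ^+ (s (lshift n i) == rshift m j)) *
   \prod_j \prod_i M i j ^+ (s (rshift m j) == lshift n i).
  rewrite [X in _ * X]exchange_big -big_split; apply: eq_bigr => i _.
  by rewrite -big_split; apply: eq_bigr => j _; rewrite exprD.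
rewrite /admissible; case: forallP => _; case: forallP => _ /=;
  by rewrite ?(mul0r, mulr0)// !mul1r !mulrA.
Qed.

Lemma admissible_lP s i i' : admissible s -> s (lshift n i) = lshift n i' -> i = i'.
Proof. by case/andP => /'forall_forallP/(_ i i')/implyP H _ /eqP /H /eqP. Qed.

Lemma admissible_rP s j j' : admissible s -> s (rshift m j) = rshift m j' -> j = j'.
Proof. by case/andP => _ /'forall_forallP/(_ j j')/implyP H /eqP /H /eqP. Qed.

Lemma admissibleP s :
  reflect ((forall i i', s (lshift n i) = lshift n i' -> i = i') /\
           (forall j j', s (rshift m j) = rshift m j' -> j = j'))
          (admissible s).
Proof.
apply: (iffP idP) => [As|[Hl Hr]].
  by split=> [i i'|j j']; [exact: admissible_lP|exact: admissible_rP].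
by apply/andP; split; apply/'forall_forallP => i i'; apply/implyP => /eqP h;
  apply/eqP; [exact: Hl h|exact: Hr h].
Qed.

(** Count the indices sent to the second block: there are n, namely the [m - fixl s] unfixed ones of
    the first block and the [fixr s] fixed ones of the second. *)
Lemma fixl_fixr s : admissible s -> (fixr s + m = fixl s + n)%N.
Proof.
move=> As; pose inr (r : 'I_(m + n)) : nat := (m <= r)%N.
have : (\sum_r inr (s r) = \sum_r inr r)%N.
  by rewrite [RHS](reindex_inj (@perm_inj _ s)).
rewrite !big_split_ord/=.
rewrite [X in _ = (X + _)%N]big1 ?add0n => [|i _]; last first.
  by rewrite /inr /= leqNgt ltn_ord.
under [X in _ = X]eq_bigr => j _ do rewrite /inr /= leq_addr.
rewrite sum1_card card_ord.
have -> : (\sum_j inr (s (rshift m j)) = fixr s)%N.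
  rewrite /fixr -sum1_card [RHS]big_mkcond/=; apply: eq_bigr => j _; rewrite inE /inr.
  case: (split_ordP (s (rshift m j))) => k sk.
    by rewrite sk /= eq_lrshift leqNgt ltn_ord.
  by rewrite sk (admissible_rP As sk) eqxx /= leq_addr.
have -> : (\sum_i inr (s (lshift n i)) = m - fixl s)%N.
  have <- : #|~: [set i | s (lshift n i) == lshift n i]| = (m - fixl s)%N.
    by rewrite cardsCs finset.setCK card_ord.
  rewrite -sum1_card [RHS]big_mkcond/=; apply: eq_bigr => i _; rewrite !inE /inr.
  case: (split_ordP (s (lshift n i))) => k sk.
    by rewrite sk (admissible_lP As sk) eqxx /= leqNgt ltn_ord.
  by rewrite sk eq_rlshift /= leq_addr.
have : (fixl s <= m)%N by rewrite -[X in (_ <= X)%N]card_ord max_card.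
lia.
Qed.

Lemma mult_le2 s i j : (mult s i j <= 2)%N.
Proof. by rewrite /mult; do 2 case: eqP. Qed.

(** * Composition with a transposition across the two blocks *)

Section Swap.
Variables (i0 : 'I_m) (j0 : 'I_n).
Let a := lshift n i0.
Let b := rshift m j0.
(** The transposition acts first: [a] and [b] exchange their images and all other images are
    kept. *)
Definition swap s : 'S_(m + n) := (tperm a b * s)%g.

Lemma swapE s r : swap s r = s (tperm a b r). Proof. by rewrite permM. Qed.

Lemma swap_inj : injective swap. Proof. exact: mulgI. Qed.

Lemma swap_lshift s i : i != i0 -> swap s (lshift n i) = s (lshift n i).
Proof. by move=> ii0; rewrite swapE tpermD// ?eq_rlshift// eq_lshift eq_sym. Qed.

Lemma swap_rshift s j : j != j0 -> swap s (rshift m j) = s (rshift m j).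
Proof. by move=> jj0; rewrite swapE tpermD// ?eq_lrshift// eq_rshift eq_sym. Qed.

Lemma odd_swap s : odd_perm (swap s) = ~~ odd_perm s.
Proof. by rewrite odd_mul_tperm eq_lrshift. Qed.

Lemma mult_swap s : (mult (swap s) i0 j0 == 2%N) = (s a == a) && (s b == b).
Proof.
rewrite /mult -/a -/b !swapE tpermL tpermR.
by case: (s a == a); case: (s b == b).
Qed.

Variable s : 'S_(m + n).
Hypotheses (sa : s a = a) (sb : s b = b).

(** Away from [a] and [b] the two permutations agree; at these indices one has fixed points and the
    other crosses blocks, and neither violates the condition. *)
Lemma admissible_swap : admissible (swap s) = admissible s.
Proof.
apply/admissibleP/admissibleP => -[Hl Hr]; split => [i i'|j j'].
- have [->|ii0] := eqVneq i i0; first by rewrite sa => /lshift_inj.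
  by rewrite -swap_lshift//; exact: Hl.
- have [->|jj0] := eqVneq j j0; first by rewrite sb => /rshift_inj.
  by rewrite -swap_rshift//; exact: Hr.
- have [->|ii0] := eqVneq i i0; last by rewrite swap_lshift//; exact: Hl.
  by rewrite swapE tpermL sb => /eqP; rewrite eq_rlshift.
- have [->|jj0] := eqVneq j j0; last by rewrite swap_rshift//; exact: Hr.
  by rewrite swapE tpermR sa => /eqP; rewrite eq_lrshift.
Qed.

Lemma fixl_swap : fixl s = (fixl (swap s)).+1.
Proof.
rewrite /fixl (cardsD1 i0) inE sa eqxx add1n; congr _.+1.
apply: eq_card => i; rewrite !inE.
have [->|ii0] /= := eqVneq i i0; last by rewrite swap_lshift.
by rewrite swapE tpermL sb eq_rlshift.
Qed.

Lemma mult_fixed : mult s i0 j0 = 0%N.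
Proof. by rewrite /mult -/a -/b sa sb eq_lrshift eq_rlshift. Qed.

(** For a pair sharing exactly one index with (i0, j0) both degrees vanish, since each permutation
    preserves the set {a, b}. *)
Lemma mult_swapD i j : (i, j) != (i0, j0) -> mult (swap s) i j = mult s i j.
Proof.
rewrite xpair_eqE negb_and /mult.
have [->|ii0] := eqVneq i i0; have [->|jj0] //= := eqVneq j j0 => _.
- rewrite swap_rshift// swapE tpermL -/a sa sb.
  by rewrite eq_rshift eq_lrshift eq_sym (negPf jj0).
- rewrite swap_lshift// swapE tpermR -/b sa sb.
  by rewrite eq_lshift eq_rlshift [_ == i]eq_sym (negPf ii0).
- by rewrite swap_lshift// swap_rshift.
Qed.

End Swap.

(** * The mean polynomial and its heat equation *)

Section HeatEquation.
Variables (R : comNzRingType) (B : 'M[R]_(m, n)).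

(* E (b + sqrt 'X * Y)^k for a centred Y of variance 1; only k <= 2 is meaningful. *)
Definition moment_poly (b : R) (k : nat) : {poly R} :=
  match k with 0 => 1 | 1 => b%:P | _ => 'X + (b ^+ 2)%:P end.

Let mu s e := moment_poly (B e.1 e.2) (mult s e.1 e.2).

(** The Leibniz expansion with each power of an entry replaced by its mean at time [t]; over the
    reals and for t >= 0 it is the f_t of the theorem. *)
Definition mean_charpoly (t : R) : {poly R} :=
  \sum_(s | admissible s) ((-1) ^+ s * \prod_e (mu s e).[t]) *: 'X^(fixl s).

(* The same bivariate polynomial as [mean_charpoly], with x fixed and theta as
   the variable. *)
Definition mean_charpoly_time (x : R) : {poly R} :=
  \sum_(s | admissible s) ((-1) ^+ s * x ^+ fixl s) *: \prod_e mu s e.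

Lemma mean_charpoly_timeE t x :
  (mean_charpoly_time x).[t] = (mean_charpoly t).[x].
Proof.
rewrite /mean_charpoly_time /mean_charpoly !horner_sum; apply: eq_bigr => s _.
by rewrite !hornerZ horner_prod hornerXn mulrAC.
Qed.

Lemma deriv_moment_poly b k : (k <= 2)%N ->
  (moment_poly b k)^`() = (k == 2%N)%:R.
Proof.
case: k => [|[|[|//]]] _ /=; rewrite ?derivD ?derivX ?derivC ?addr0//.
Qed.

Lemma fix_pairs s :
  (\sum_e ((s (lshift n e.1) == lshift n e.1) && (s (rshift m e.2) == rshift m e.2))
   = fixl s * fixr s)%N.
Proof.
rewrite -(pair_bigA _ (fun i j => ((s (lshift n i) == lshift n i)
   && (s (rshift m j) == rshift m j) : nat)))/=.
rewrite /fixl /fixr -!sum1_card big_distrl/= [RHS]big_mkcond/=.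
apply: eq_bigr => i _; rewrite inE mul1n; case: eqP => _; last first.
  by rewrite big1.
by rewrite [RHS]big_mkcond; apply: eq_bigr => j _; rewrite inE; case: eqP.
Qed.

(** Reindexing by [swap] at [e] turns the permutations of degree 2 in [e] into those fixing both of
    its indices. The sign flips, the power of [x] is one below [fixl] of the new index, and the
    factor restored at [e] is 1. *)
Lemma sum_mult2_swap (t x : R) (e : 'I_m * 'I_n) :
  \sum_(s | admissible s) ((-1) ^+ s * x ^+ fixl s) *
     ((mult s e.1 e.2 == 2%N)%:R * \prod_(e' | e' != e) (mu s e').[t])
  = - \sum_(s | admissible s) ((s (lshift n e.1) == lshift n e.1)
       && (s (rshift m e.2) == rshift m e.2))%:R *
      ((-1) ^+ s * (\prod_e' (mu s e').[t]) * x ^+ (fixl s).-1).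
Proof.
rewrite big_mkcond (reindex_inj (@swap_inj e.1 e.2)) -sumrN [RHS]big_mkcond/=.
apply: eq_bigr => s _; rewrite mult_swap.
have [/andP[/eqP sa /eqP sb]|_] := boolP (_ && _); last first.
  by rewrite !mul0r mulr0 oppr0 !if_same.
rewrite admissible_swap//; case: ifP => // _.
rewrite (fixl_swap sa sb)/= !mul1r odd_swap.
have mu1 : mu s e = 1 by rewrite /mu mult_fixed.
rewrite [in RHS](bigD1 e)//= mu1 hornerC mul1r.
rewrite (eq_bigr (fun e' => (mu s e').[t])) => [|e' e'e]; last first.
  by rewrite /mu mult_swapD// -!surjective_pairing.
by rewrite signrN !mulNr mulrAC.
Qed.

(** An admissible permutation with p fixed points in the first block fixes p (n - m + p) pairs of
    indices, one from each block; the identity p (n - m + p) = (n - m + 1) p + p (p - 1) gives the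
    coefficients of f' and x f''. *)
Lemma mean_charpoly_heat (m_le_n : (m <= n)%N) (t x : R) :
  (mean_charpoly_time x)^`().[t] =
  - ((n - m).+1%:R * (mean_charpoly t)^`().[x] +
     x * (mean_charpoly t)^`()^`().[x]).
Proof.
(* Only the factors with [mult] equal to 2 depend on time, with derivative 1. *)
transitivity (\sum_(s | admissible s) \sum_e ((-1) ^+ s * x ^+ fixl s) *
     ((mult s e.1 e.2 == 2%N)%:R * \prod_(e' | e' != e) (mu s e').[t])).
  rewrite /mean_charpoly_time raddf_sum /= horner_sum; apply: eq_bigr => s _.
  rewrite derivZ hornerZ deriv_prod horner_sum mulr_sumr; apply: eq_bigr => e _.
  by rewrite hornerM horner_prod deriv_moment_poly ?mult_le2// -polyC_natr hornerC.
rewrite exchange_big/=; under eq_bigr do rewrite sum_mult2_swap.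
rewrite sumrN; congr (- _); rewrite exchange_big/=.
rewrite /mean_charpoly !raddf_sum/= !horner_sum !mulr_sumr -big_split/=.
apply: eq_bigr => s As; rewrite -mulr_suml -natr_sum fix_pairs.
rewrite !derivZ !hornerZ derivXn derivMn derivXn !hornerMn !hornerXn.
have := fixl_fixr As; set c := (_ * \prod_e _); move: (fixl s) (fixr s) => p q pq.
have -> : q = (n - m + p)%N by lia.
case: p pq => [|[|p]] pq /=; rewrite ?mul0n ?mulr0n ?mulr0 ?mul0r ?addr0//.
  by rewrite mul1n addn1 mulr1n.
rewrite -[_ *+ _ *+ _]mulr_natr -[x ^+ p *+ _]mulr_natr -[x ^+ _ *+ _]mulr_natr.
rewrite exprS natrM natrD.
rewrite -[(n - m).+1%:R]natr1 -[p.+2%:R]natr1 -[p.+1%:R]natr1.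
move: (n - m)%:R (p%:R : R) (x ^+ p) => u v w.
ring.
Qed.

End HeatEquation.
End BipartitePermutations.

Local Open Scope classical_set_scope.

(** * Derivatives relative to an interval *)

Section RelativeDerivatives.
Context {R : realType}.

(** The point [a] is approached inside [J] along the segment to another point of [J]. Properness of
    this filter is what makes limits along it unique. *)
Lemma within_dnbhs_interval_proper (J : set R) (a : R) :
  is_interval J -> (exists x y, [/\ J x, J y & x < y]) -> J a ->
  ProperFilter (within J a^').
Proof.
move=> Jitv [x [y [Jx Jy xy]]] Ja.
have [c Jc ca] : exists2 c, J c & c != a.
  have [xa|] := eqVneq x a; last by exists x.
  by exists y => //; rewrite -xa gt_eqF.
apply: Build_ProperFilter_ex => A.
rewrite /within /= /dnbhs /within /= => /nbhs_ballP[e /= e0 Ae].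
have ca0 : 0 < `|c - a| by rewrite normr_gt0 subr_eq0.
(* This [t] places the point within e / 2 of [a] and keeps it on the segment from [a] to [c]. *)
pose t := Num.min 1 (e / 2 / `|c - a|).
have t0 : 0 < t by rewrite lt_min ltr01/= !divr_gt0.
have t1 : t <= 1 by rewrite ge_min lexx.
exists (a + t * (c - a)); apply: Ae.
- rewrite /ball /= opprD addrA subrr add0r normrN normrM gtr0_norm//.
  apply: (@le_lt_trans _ _ (e / 2)); last by rewrite ltr_pdivrMr// mulr_natr mulr2n ltrDl.
  by rewrite -ler_pdivlMr// ge_min lexx orbT.
- rewrite -subr_eq0 addrAC subrr add0r mulf_neq0 ?subr_eq0 //.
  by rewrite gt_eqF.
- have [ac|ca'] := leP a c.
    apply: (Jitv a c) => //; apply/andP; split; nra.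
  by apply: (Jitv c a) => //; apply/andP; split; nra.
Qed.

(** Factor p - p(a) as q (X - a): the quotient equals q away from a, and q(a) = p'(a) by the product
    rule. *)
Lemma horner_diff_quotient_cvg (p : {poly R}) (a : R) :
  (fun t => (p.[t] - p.[a]) / (t - a)) @ a^' --> p^`().[a].
Proof.
have /factor_theorem[q pq] : root (p - p.[a]%:P) a.
  by rewrite /root !hornerE subrr.
have -> : p^`().[a] = q.[a].
  have : (p - p.[a]%:P)^`().[a] = (q * ('X - a%:P))^`().[a] by rewrite pq.
  rewrite derivB derivC subr0 derivM derivXsubC hornerD !hornerM hornerXsubC.
  by rewrite subrr mulr0 add0r hornerC mulr1.
have cq : q.[t] @[t --> a^'] --> q.[a].
  apply: cvg_trans (@continuous_horner _ q a).
  exact/cvg_app/nbhs_dnbhs.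
apply: cvg_trans cq; apply: near_eq_cvg.
near=> t.
have ta : t != a by near: t; exact: nbhs_dnbhs_neq.
have -> : p.[t] - p.[a] = q.[t] * (t - a).
  by rewrite -[t - a]hornerXsubC -hornerM -pq !hornerE.
by rewrite mulfK// subr_eq0.
Unshelve. all: by end_near. Qed.

(** Write f t as f a plus the difference quotient times t - a; the second term tends to 0. *)
Lemma derivable_within_cvg (J : set R) (f : R -> R) (a : R) :
  derivable_within J f a -> f t @[t --> within J a^'] --> f a.
Proof.
rewrite /derivable_within; set D := lim _; move=> cD.
have ta : (t - a) @[t --> within J a^'] --> 0.
  rewrite -[X in _ --> X](subrr a).
  apply: cvgB; last exact: cvg_cst.
  apply: cvg_trans; first exact: cvg_within.
  exact: nbhs_dnbhs.
have : f a + (f t - f a) / (t - a) * (t - a) @[t --> within J a^'] --> f a + D * 0.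
  by apply: cvgD; [exact: cvg_cst|exact: cvgM].
rewrite mulr0 addr0; apply: cvg_trans; apply: near_eq_cvg.
have nE : \forall t \near within J a^', t != a.
  apply: (@cvg_within _ _ _ J).
  exact: (@nbhs_dnbhs_neq R a).
near=> t.
have tNa : t != a by near: t; exact: nE.
by rewrite divfK ?subr_eq0// addrC subrK.
Unshelve. all: by end_near. Qed.

End RelativeDerivatives.

(** A nonzero difference would have as many distinct roots 0, 1, ... as its size, which exceeds its
    degree. *)
Lemma poly_horner_inj (R : numDomainType) (p q : {poly R}) :
  (forall x, p.[x] = q.[x]) -> p = q.
Proof.
move=> pq; apply/eqP; rewrite -subr_eq0; apply/negP => /negP pq0.
have := max_poly_roots pq0 (rs := [seq k%:R | k <- iota 0 (size (p - q))]).
rewrite size_map size_iota ltnn => H.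
have : false by apply: H;
  [apply/allP => _ /mapP[k _ ->]; rewrite /root !hornerE pq subrr| rewrite map_inj_uniq ?iota_uniq// => k l /eqP; rewrite eqr_nat => /eqP].
by [].
Qed.

Lemma horner_deriv_prod_XsubC (F : fieldType) (I : finType) (P : pred I)
    (l : I -> F) (a : F) : (forall j, P j -> a != l j) ->
  (\prod_(j | P j) ('X - (l j)%:P))^`().[a] =
  \prod_(j | P j) (a - l j) * \sum_(j | P j) (a - l j)^-1.
Proof.
move=> al.
(* The value is carried through the induction because the product rule for the derivative needs
   it. *)
suff : (\prod_(j | P j) ('X - (l j)%:P)).[a] = \prod_(j | P j) (a - l j) /\
  (\prod_(j | P j) ('X - (l j)%:P))^`().[a] =
  \prod_(j | P j) (a - l j) * \sum_(j | P j) (a - l j)^-1 by case.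
elim/big_rec3: _ => [|j s q p Pj [pa dpa]].
  by rewrite hornerC derivC hornerC mulr0.
rewrite hornerM pa hornerXsubC; split=> //.
rewrite derivM derivXsubC hornerD !hornerM hornerC hornerXsubC pa dpa mul1r.
by rewrite mulrDr mulrAC divff ?mul1r ?mulrA// subr_eq0 al.
Qed.

(** * Expectations of products of independent variables *)

Section IndependentProducts.
Context {d : measure_display} {T : measurableType d} {R : realType}.
Variable P : probability T R.
Import HBNNSimple.

(** Here [W] stands for a product of other variables; its factorization against events of [X]
    extends by linearity over the level sets of [g]. *)
Lemma ge0_integral_sfun_mul (W : T -> R) (X : {RV P >-> R}) (g : {nnsfun R >-> R}) :
  measurable_fun setT W -> (forall w, 0 <= W w) ->
  (forall A : set R, measurable A ->
    \int[P]_w (W w * \1_A (X w))%:E = \int[P]_w (W w)%:E * P (X @^-1` A))%E ->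
  (\int[P]_w (W w * g (X w))%:E = \int[P]_w (W w)%:E * \int[P]_w (g (X w))%:E)%E.
Proof.
move=> mW W0 HW.
set s := finmap.enum_fset (fset_set (range g)).
have s0 (i : 'I_(size s)) : 0 <= s`_i.
  have : s`_i \in s by rewrite mem_nth.
  by rewrite in_fset_set// inE => -[x _ <-]; exact: fun_ge0.
have mA (i : 'I_(size s)) : measurable (g @^-1` [set s`_i]).
  by rewrite -[X in measurable X]setTI; exact: measurable_funP.
have mI (i : 'I_(size s)) : measurable_fun setT
    (fun w => (\1_(g @^-1` [set s`_i]) (X w) : R)).
  exact: measurableT_comp (measurable_indic _) (measurable_funPT X).
have gE w : g (X w) = \sum_(i < size s) s`_i * \1_(g @^-1` [set s`_i]) (X w).
  exact: fimfunEord.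
have -> : (\int[P]_w (g (X w))%:E =
    \sum_(i < size s) (s`_i)%:E * P (X @^-1` (g @^-1` [set s`_i])))%E.
  under eq_integral do rewrite gE -sumEFin.
  rewrite ge0_integral_sum//; last 2 first.
  - by move=> i; apply/measurable_EFinP/measurable_funM.
  - by move=> i w _; rewrite lee_fin mulr_ge0.
  apply: eq_bigr => i _.
  under eq_integral do rewrite EFinM.
  rewrite ge0_integralZl_EFin//; last exact/measurable_EFinP.
  congr (_ * _)%E; rewrite [LHS](_ : _ =
    \int[P]_w (\1_(X @^-1` (g @^-1` [set s`_i])) w)%:E)%E//.
  rewrite integral_indic ?setIT//.
  by rewrite -[X in measurable X]setTI; exact: measurable_funP.
under eq_integral do rewrite gE mulr_sumr -sumEFin.
rewrite ge0_integral_sum//; last 2 first.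
- by move=> i; apply/measurable_EFinP/measurable_funM => //; apply: measurable_funM.
- by move=> i w _; rewrite lee_fin !mulr_ge0.
rewrite ge0_sume_distrr; last by move=> i _; rewrite mule_ge0 ?lee_fin.
apply: eq_bigr => i _.
under eq_integral do rewrite mulrCA EFinM.
rewrite ge0_integralZl_EFin//; last 2 first.
- by move=> w _; rewrite lee_fin mulr_ge0.
- by apply/measurable_EFinP/measurable_funM.
by rewrite HW// muleCA.
Qed.

(** Approximate [phi] from below by simple functions and use monotone convergence on both sides;
    finiteness of the integral of [W] lets it multiply the second limit. *)
Lemma ge0_integral_mul_comp (W : T -> R) (X : {RV P >-> R}) (phi : R -> R) :
  measurable_fun setT W -> (forall w, 0 <= W w) ->
  (\int[P]_w (W w)%:E \is a fin_num)%E ->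
  (forall A : set R, measurable A ->
    \int[P]_w (W w * \1_A (X w))%:E = \int[P]_w (W w)%:E * P (X @^-1` A))%E ->
  measurable_fun setT phi -> (forall x, 0 <= phi x) ->
  (\int[P]_w (W w * phi (X w))%:E =
   \int[P]_w (W w)%:E * \int[P]_w (phi (X w))%:E)%E.
Proof.
move=> mW W0 finW HW mphi phi0.
have mphi' : measurable_fun setT (EFin \o phi) by exact/measurable_EFinP.
have phi0' : forall x, setT x -> (0 <= (EFin \o phi) x)%E.
  by move=> x _; rewrite lee_fin.
pose g := nnsfun_approx measurableT mphi'.
have cg x : (g n x)%:E @[n --> \oo] --> (phi x)%:E.
  exact: (cvg_nnsfun_approx measurableT mphi' phi0').
have ndg x : {homo (fun n => g n x) : n m / (n <= m)%N >-> n <= m}.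
  by move=> n k nk; exact/lefP/nd_nnsfun_approx.
have mgX n : measurable_fun setT (fun w => g n (X w)).
  exact: measurableT_comp (measurable_funPT (g n)) (measurable_funPT X).
have lim1 : (\int[P]_w (W w * g n (X w))%:E)%E @[n --> \oo] -->
    (\int[P]_w (W w * phi (X w))%:E)%E.
  rewrite (_ : (\int[P]_w (W w * phi (X w))%:E)%E =
     (\int[P]_w (limn (fun n => (W w * g n (X w))%:E)))%E); last first.
    apply: eq_integral => w _; apply/esym/cvg_lim => //.
    rewrite EFinM; under eq_fun do rewrite EFinM.
    by apply: cvgeZl => //; exact: cg.
  apply: cvg_monotone_convergence => //.
  - by move=> n; apply/measurable_EFinP/measurable_funM.
  - by move=> n w _; rewrite lee_fin mulr_ge0.
  - by move=> w _ n k nk; rewrite lee_fin ler_wpM2l// ndg.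
have lim2 : (\int[P]_w (g n (X w))%:E)%E @[n --> \oo] -->
    (\int[P]_w (phi (X w))%:E)%E.
  rewrite (_ : (\int[P]_w (phi (X w))%:E)%E =
     (\int[P]_w (limn (fun n => (g n (X w))%:E)))%E); last first.
    by apply: eq_integral => w _; apply/esym/cvg_lim => //; exact: cg.
  apply: cvg_monotone_convergence => //.
  - by move=> n; apply/measurable_EFinP.
  - by move=> n w _; rewrite lee_fin.
  - by move=> w _ n k nk; rewrite lee_fin ndg.
apply: (cvg_unique _ lim1) => //.
rewrite (_ : (fun n => _) =
    (fun n => \int[P]_w (W w)%:E * \int[P]_w (g n (X w))%:E)%E).
  exact: cvgeZl.
by apply/funext => n; exact: ge0_integral_sfun_mul.
Qed.

Variables (I : finType) (X : I -> {RV P >-> R}).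
Hypothesis X_indep : mutually_independent X.

Lemma ge0_integral_prod_independent (phi : I -> R -> R) (c : I -> R) :
  (forall i, measurable_fun setT (phi i)) -> (forall i x, 0 <= phi i x) ->
  (forall i, \int[P]_w (phi i (X i w))%:E = (c i)%:E)%E ->
  (\int[P]_w (\prod_i phi i (X i w))%:E = (\prod_i c i)%:E)%E.
Proof.
move=> mphi phi0 cE.
suff H (s : seq I) : forall (psi : I -> R -> R) (b : I -> R),
    (forall i, measurable_fun setT (psi i)) -> (forall i x, 0 <= psi i x) ->
    (forall i, \int[P]_w (psi i (X i w))%:E = (b i)%:E)%E ->
    (forall i, i \notin s -> exists2 A, measurable A & psi i = \1_A) ->
    (\int[P]_w (\prod_i psi i (X i w))%:E = (\prod_i b i)%:E)%E.
  by apply: (H (enum I)) => // i; rewrite mem_enum.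
(* Outside [s] the factors are indicators; they are replaced one index at a
   time by arbitrary functions. *)
elim: s => [|e s IH] psi b mpsi psi0 bE psiA.
  (* With every factor an indicator, the product is the indicator of an intersection, and
     independence over the full index set applies. *)
  have /choice[A HA] : forall i, exists A, measurable A /\ psi i = \1_A.
    by move=> i; have [A mA ->] := psiA i isT; exists A.
  have mA i : measurable (A i) by case: (HA i).
  have mXA i : measurable (X i @^-1` A i).
    by rewrite -[X in measurable X]setTI; exact: measurable_funP.
  have bP i : P (X i @^-1` A i) = (b i)%:E.
    rewrite -bE (HA i).2 [RHS](_ : _ = \int[P]_w (\1_(X i @^-1` A i) w)%:E)%E//.
    by rewrite integral_indic// setIT.
  have := @X_indep [set: I]%SET A mA.
  under [in RHS]eq_bigl do rewrite inE.
  under [in RHS]eq_bigr do rewrite bP.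
  rewrite prodEFin => <-.
  set C := \bigcap_(i in _) _.
  have mC : measurable C.
    by apply: fin_bigcap_measurable => //; exact: finite_finset.
  rewrite [RHS](_ : _ = \int[P]_w (\1_C w)%:E)%E; last first.
    by rewrite integral_indic// setIT.
  apply: eq_integral => w _; congr EFin.
  rewrite indicE; have [wC|wC] := boolP (w \in C).
    rewrite big1// => i _; rewrite (HA i).2 indicE mem_set//.
    by move: wC; rewrite inE => /(_ i); apply; rewrite /= inE.
  apply/eqP; rewrite prodf_seq_eq0; apply/hasP.
  have [i wi] : exists i, ~ A i (X i w).
    apply/existsNP => Aw; move/negP: wC; apply; rewrite inE => i _; exact: Aw.
  exists i; rewrite ?mem_index_enum//= (HA i).2 indicE memNset//.
have WE w : \prod_i psi i (X i w) =
    (\prod_(i | i != e) psi i (X i w)) * psi e (X e w).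
  by rewrite (bigD1 e)//= mulrC.
under eq_integral do rewrite WE.
(* With an indicator at [e] the induction hypothesis applies; this factorization then extends from
   indicators to [psi e]. *)
have HI A : measurable A ->
    (\int[P]_w (\prod_(i | i != e) psi i (X i w) * \1_A (X e w))%:E
     = (\prod_(i | i != e) b i)%:E * P (X e @^-1` A))%E.
  move=> mA.
  have mXA : measurable (X e @^-1` A).
    by rewrite -[X in measurable X]setTI; exact: measurable_funP.
  pose psi' i := if i == e then \1_A : R -> R else psi i.
  pose b' i := if i == e then fine (P (X e @^-1` A)) else b i.
  have <- : (\prod_i b' i)%:E =
      ((\prod_(i | i != e) b i)%:E * P (X e @^-1` A))%E.
    rewrite (bigD1 e)//= {1}/b' eqxx EFinM fineK ?fin_num_measure// muleC.
    by congr (_%:E * _)%E; apply: eq_bigr => i /negbTE ie; rewrite /b' ie.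
  have <- : (\int[P]_w (\prod_i psi' i (X i w))%:E = (\prod_i b' i)%:E)%E.
    apply: IH.
    - by move=> i; rewrite /psi'; case: ifP => // _; exact: measurable_indic.
    - by move=> i x; rewrite /psi'; case: ifP.
    - move=> i; rewrite /psi' /b'; case: eqP => [->|//].
      rewrite [LHS](_ : _ = \int[P]_w (\1_(X e @^-1` A) w)%:E)%E//.
      by rewrite integral_indic// setIT fineK// fin_num_measure.
    - move=> i; rewrite /psi'; case: eqP => [_|/eqP ie] is_; first by exists A.
      by apply: psiA; rewrite inE negb_or ie.
  apply: eq_integral => w _; rewrite [in RHS](bigD1 e)//= [in RHS]mulrC [psi' e]/psi' eqxx.
  by congr (_ * _)%:E; apply: eq_bigr => i /negbTE ie; rewrite /psi' ie.
have EW : (\int[P]_w (\prod_(i | i != e) psi i (X i w))%:E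
     = (\prod_(i | i != e) b i)%:E)%E.
  have := HI setT measurableT.
  rewrite preimage_setT probability_setT mule1 => <-.
  by apply: eq_integral => w _; rewrite indicT mulr1.
rewrite ge0_integral_mul_comp//.
- by rewrite EW bE -EFinM mulrC [in RHS](bigD1 e).
- under eq_fun do rewrite -big_filter.
  apply: measurable_prod => i _; exact: measurableT_comp (mpsi i) (measurable_funPT _).
- by move=> w; rewrite prodr_ge0.
- by rewrite EW.
- by move=> A mA; rewrite HI// EW.
Qed.

(** Split each factor into positive and negative parts, expand over all choices of parts, and apply
    the nonnegative case to each term; expanding the product of the [c i] in the same way matches
    the terms. *)
Lemma integral_prod_independent (phi : I -> R -> R) (c : I -> R) :
  (forall i, measurable_fun setT (phi i)) ->
  (forall i, P.-integrable setT (fun w => (phi i (X i w))%:E)) ->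
  (forall i, \int[P]_w (phi i (X i w))%:E = (c i)%:E)%E ->
  P.-integrable setT (fun w => (\prod_i phi i (X i w))%:E) /\
  (\int[P]_w (\prod_i phi i (X i w))%:E = (\prod_i c i)%:E)%E.
Proof.
move=> mphi iphi cE.
pose part (i : I) (b : bool) : R -> R := if b then (phi i)^\- else (phi i)^\+.
have mpart i b : measurable_fun setT (part i b).
  by rewrite /part; case: b; [exact: measurable_funrneg|exact: measurable_funrpos].
have part0 i b x : 0 <= part i b x.
  by rewrite /part; case: b; [exact: funrneg_ge0|exact: funrpos_ge0].
have mpartX i b : measurable_fun setT (fun w => part i b (X i w)).
  exact: measurableT_comp (mpart i b) (measurable_funPT (X i)).
have ipart i b : P.-integrable setT (fun w => (part i b (X i w))%:E).
  rewrite /part; case: b.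
  - exact: (integrable_funrneg (f := phi i \o X i) measurableT (iphi i)).
  - exact: (integrable_funrpos (f := phi i \o X i) measurableT (iphi i)).
pose cp i b := fine (\int[P]_w (part i b (X i w))%:E)%E.
have cpE i b : (\int[P]_w (part i b (X i w))%:E = (cp i b)%:E)%E.
  by rewrite fineK// integrable_fin_num.
have phiE i x : phi i x = \sum_(b : bool) (-1) ^+ b * part i b x.
  rewrite big_bool/= addrC.
  rewrite expr0 mul1r expr1 mulN1r /part.
  by rewrite -[in LHS](funrposBneg (phi i)).
have {}cE i : c i = \sum_(b : bool) (-1) ^+ b * cp i b.
  apply: EFin_inj; rewrite -cE.
  rewrite big_bool/= addrC.
  rewrite expr0 mul1r expr1 mulN1r EFinB -!cpE.
  rewrite -(integralB_EFin measurableT (ipart i false) (ipart i true)).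
  apply: eq_integral => w _.
  by rewrite /part /= -EFinB -[in LHS](funrposBneg (phi i)).
pose sg (f : {ffun I -> bool}) : R := \prod_i (-1) ^+ f i.
pose F (f : {ffun I -> bool}) w := \prod_i part i (f i) (X i w).
have prodE w : (\prod_i phi i (X i w))%:E = (\sum_f (sg f)%:E * (F f w)%:E)%E.
  under eq_bigr do rewrite phiE.
  rewrite bigA_distr_bigA -sumEFin; apply: eq_bigr => f _.
  by rewrite big_split.
have FE (f : {ffun I -> bool}) : (\int[P]_w (F f w)%:E = (\prod_i cp i (f i))%:E)%E.
  by apply: (@ge0_integral_prod_independent (fun i => part i (f i))
    (fun i => cp i (f i))).
have iF f : P.-integrable setT (fun w => (F f w)%:E).
  apply/integrableP; split.
    by apply/measurable_EFinP/measurable_prod => j _; exact: mpartX.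
  under eq_integral => w _ do rewrite gee0_abs ?lee_fin ?prodr_ge0//.
  by rewrite FE ltry.
have iS (f : {ffun I -> bool}) :
    P.-integrable setT (fun w => (sg f)%:E * (F f w)%:E)%E.
  exact: integrableZl.
split.
  under eq_fun do rewrite prodE.
  exact: integrable_sum.
under eq_integral do rewrite prodE.
rewrite integral_sum//.
under [in RHS]eq_bigr do rewrite cE.
rewrite bigA_distr_bigA -sumEFin; apply: eq_bigr => f _.
by rewrite integralZl// FE -EFinM big_split.
Qed.

End IndependentProducts.

(** * Moments of a symmetric variable of variance 1 *)

Section Moments.
Context {d : measure_display} {T : measurableType d} {R : realType}.
Variable P : probability T R.
Variable X : {RV P >-> R}.

Lemma integrable_exp_of_moments k :
  all_moments_finite X -> P.-integrable setT (fun w => (X w ^+ k)%:E).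
Proof.
move=> /(_ k); rewrite unlock => Xk; apply/integrableP; split.
  apply/measurable_EFinP; exact: (measurable_funX k (measurable_funPT X)).
apply: le_lt_trans Xk; rewrite le_eqVlt; apply/orP; left; apply/eqP.
by apply: eq_integral => w _; rewrite -normrX.
Qed.

(** Passing to laws, the mean equals its own opposite; being finite, it is 0. *)
Lemma expectation_symmetric : symmetric_RV X ->
  P.-integrable setT (fun w => (X w)%:E) -> (\int[P]_w (X w)%:E = 0)%E.
Proof.
move=> Xsym iX.
pose Y : {RV P >-> R} := (- X)%R.
have mE : measurable_fun [set: R] (EFin : R -> \bar R).
  exact/measurable_EFinP.
have iY : P.-integrable setT (fun w => (Y w)%:E).
  by rewrite [X in integrable _ _ X](_ : _ = (\- (fun w => (X w)%:E))%E)//;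
    exact: integrableN.
have XN : (\int[P]_w (X w)%:E = - \int[P]_w (X w)%:E)%E.
  rewrite -integralN; last exact: integrable_add_def.
  rewrite -[LHS](integral_distribution mE iX).
  rewrite -[RHS](integral_distribution mE iY).
  by apply: eq_measure_integral => A mA _; exact: Xsym.
have := integrable_fin_num measurableT iX.
move: XN; case: (\int[P]_w _)%E => // r [/eqP].
by rewrite -subr_eq0 opprK -mulr2n mulrn_eq0/= => /eqP ->.
Qed.

Lemma second_moment_centered : (\int[P]_w (X w)%:E = 0)%E -> 'V_P[X] = 1%E ->
  (\int[P]_w (X w ^+ 2)%:E = 1)%E.
Proof.
move=> EX <-; rewrite /variance unlock.
have -> : ('E_P[X] = 0)%E by rewrite unlock.
by rewrite unlock; apply: eq_integral => w _; rewrite !fctE /= !subr0 expr2.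
Qed.

End Moments.

(** * Motion of the roots *)

Section ExpectedCharpoly.
Context {d : measure_display} {T : measurableType d} {R : realType}.
Variable P : probability T R.

(** The power is at most quadratic in [X], whose mean is 0 and whose square has mean 1, so [r]
    enters the result only as r^2. *)
Lemma integral_moment_poly (X : {RV P >-> R}) (b r : R) (k : nat) :
  (k <= 2)%N -> all_moments_finite X ->
  (\int[P]_w (X w)%:E = 0)%E -> (\int[P]_w (X w ^+ 2)%:E = 1)%E ->
  P.-integrable setT (fun w => ((b + r * X w) ^+ k)%:E) /\
  (\int[P]_w ((b + r * X w) ^+ k)%:E = (moment_poly b k).[r ^+ 2]%:E)%E.
Proof.
move=> k2 Xmom X1 X2.
have i1 : P.-integrable setT (fun w => (X w)%:E).
  exact: integrable_exp_of_moments 1 Xmom.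
have i2 := integrable_exp_of_moments 2 Xmom.
have quad (f : T -> R) (a0 a1 a2 : R) :
    (forall w, f w = a0 + a1 * X w + a2 * X w ^+ 2) ->
    P.-integrable setT (fun w => (f w)%:E) /\
    (\int[P]_w (f w)%:E = (a0 + a2)%:E)%E.
  move=> fE.
  have E w : ((f w)%:E
      = (a0%:E + a1%:E * (X w)%:E) + a2%:E * (X w ^+ 2)%:E)%E by rewrite fE.
  have j0 : P.-integrable setT (fun=> a0%:E).
    exact: finite_measure_integrable_cst.
  have j1 : P.-integrable setT (fun w => a1%:E * (X w)%:E)%E by exact: integrableZl.
  have j2 : P.-integrable setT (fun w => a2%:E * (X w ^+ 2)%:E)%E by exact: integrableZl.
  have j01 : P.-integrable setT (fun w => a0%:E + a1%:E * (X w)%:E)%E.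
    exact: integrableD.
  split; first by under eq_fun do rewrite E; exact: integrableD.
  under eq_integral do rewrite E.
  rewrite integralD// integralD// !integralZl// X1 X2 mule0 adde0 mule1.
  by have := expectation_cst P a0; rewrite unlock => ->.
case: k k2 => [|[|[|//]]] _ /=.
- by rewrite hornerC -[1 in RHS]addr0; apply: (quad _ 1 0 0) => w; ring.
- by rewrite hornerC -[b in RHS]addr0; apply: (quad _ b r 0) => w; ring.
- rewrite hornerD hornerX hornerC addrC.
  by apply: (quad _ (b ^+ 2) (2 * b * r) (r ^+ 2)) => w; ring.
Qed.

(** Integrate the Leibniz expansion term by term; independence turns the mean of each monomial into
    a product of moment polynomials. Nonnegativity of [theta] makes it the square of its root. *)
Lemma expected_charpolyE (m n : nat) (B : 'M[R]_(m, n))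
    (X : 'I_m -> 'I_n -> {RV P >-> R}) (theta x : R) :
  mutually_independent (fun ij : 'I_m * 'I_n => X ij.1 ij.2) ->
  (forall i j, symmetric_RV (X i j)) ->
  (forall i j, all_moments_finite (X i j)) ->
  (forall i j, 'V_P[X i j] = 1%E) -> 0 <= theta ->
  expected_charpoly B X theta x = ((mean_charpoly B theta).[x])%:E.
Proof.
move=> Xind Xsym Xmom Xvar theta0.
have X1 i j : (\int[P]_w (X i j w)%:E = 0)%E.
  by apply: expectation_symmetric => //; exact: integrable_exp_of_moments 1 _.
have X2 i j : (\int[P]_w (X i j w ^+ 2)%:E = 1)%E.
  exact: second_moment_centered.
pose Z s w : R := \prod_(e : 'I_m * 'I_n)
  (B e.1 e.2 + Num.sqrt theta * X e.1 e.2 w) ^+ mult s e.1 e.2.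
have ZE s : P.-integrable setT (fun w => (Z s w)%:E) /\
    (\int[P]_w (Z s w)%:E =
     (\prod_e (moment_poly (B e.1 e.2) (mult s e.1 e.2)).[theta])%:E)%E.
  apply: (integral_prod_independent Xind
    (phi := fun e y => (B e.1 e.2 + Num.sqrt theta * y) ^+ mult s e.1 e.2)).
  - move=> e; apply: measurable_funX; apply: measurable_funD.
      exact: measurable_cst.
    exact: (measurable_funM (f := fun=> _) (g := id)).
  - by move=> e; have [] := integral_moment_poly (B e.1 e.2) (Num.sqrt theta)
      (mult_le2 s e.1 e.2) (Xmom e.1 e.2) (X1 _ _) (X2 _ _).
  - move=> e; have [_] := integral_moment_poly (B e.1 e.2) (Num.sqrt theta)
      (mult_le2 s e.1 e.2) (Xmom e.1 e.2) (X1 _ _) (X2 _ _).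
    by rewrite sqr_sqrtr.
rewrite /expected_charpoly unlock.
pose c (s : 'S_(m + n)) : R := (-1) ^+ s * x ^+ fixl s.
have detE w : (\det (x%:M - (B + Num.sqrt theta *: random_matrix X w) *m
      (B + Num.sqrt theta *: random_matrix X w)^T))%:E =
    (\sum_(s | admissible s) (c s)%:E * (Z s w)%:E)%E.
  rewrite charpoly_gram_expansion -sumEFin; apply: eq_bigr => s _.
  congr (_ * _)%:E; apply: eq_bigr => e _.
  by rewrite !mxE.
under eq_integral do rewrite detE.
rewrite integral_sum//; last by move=> s; apply: integrableZl => //; case: (ZE s).
rewrite /mean_charpoly horner_sum -sumEFin; apply: eq_bigr => s _.
have [iZ EZ] := ZE s.
rewrite integralZl// EZ -EFinM hornerZ hornerXn /c; congr EFin.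
by rewrite mulrAC.
Qed.

End ExpectedCharpoly.

(** * Velocity of the roots from the heat equation *)

Lemma root_velocity (R : realType) (m n : nat) (m_le_n : (m <= n)%N)
    (B : 'M[R]_(m, n)) (J : set R) (lambda : 'I_m -> R -> R) :
  is_interval J -> (exists a b, [/\ J a, J b & a < b]) ->
  (forall i theta, J theta -> derivable_within J (lambda i) theta) ->
  (forall theta, J theta -> injective (fun i => lambda i theta)) ->
  (forall theta, J theta -> forall x,
     (mean_charpoly B theta).[x] = \prod_(i < m) (x - lambda i theta)) ->
  forall i theta, J theta ->
    derive_within J (lambda i) theta =
    n%:R + \sum_(j < m | j != i)
      (lambda i theta + lambda j theta) / (lambda i theta - lambda j theta).
Proof.
move=> Jitv Jlen lder linj lroots i theta Jtheta.
have FF := within_dnbhs_interval_proper Jitv Jlen Jtheta.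
set D := derive_within _ _ _; pose a := lambda i theta.
have al j : j != i -> a != lambda j theta.
  by apply: contraNneq => /(linj _ Jtheta) ->.
pose Q := \prod_(j < m | j != i) (a - lambda j theta).
pose S := \sum_(j < m | j != i) (a - lambda j theta)^-1.
have Q0 : Q != 0 by apply/prodf_neq0 => j ji; rewrite subr_eq0 al.
have fE : mean_charpoly B theta =
    ('X - a%:P) * \prod_(j < m | j != i) ('X - (lambda j theta)%:P).
  rewrite -[RHS](bigD1 i (P := predT) (F := fun j => 'X - (lambda j theta)%:P))//.
  apply: poly_horner_inj => x; rewrite lroots// horner_prod.
  by apply: eq_bigr => j _; rewrite hornerXsubC.
have f1 : (mean_charpoly B theta)^`().[a] = Q.
  rewrite fE derivM derivXsubC !hornerE subrr mul0r addr0 horner_prod.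
  by apply: eq_bigr => j _; rewrite hornerXsubC.
(* At a, the second derivative of (X - a) q is 2 q'(a), and q'(a) comes from the logarithmic
   derivative. *)
have f2 : (mean_charpoly B theta)^`()^`().[a] = 2 * (Q * S).
  rewrite fE derivM derivXsubC mul1r derivD derivM derivXsubC mul1r.
  rewrite !hornerD hornerM hornerXsubC subrr mul0r addr0.
  by rewrite horner_deriv_prod_XsubC// mulr2n mulrDl mul1r.
pose g := mean_charpoly_time B a.
have gE t : J t -> g.[t] = \prod_(j < m) (a - lambda j t).
  by move=> Jt; rewrite mean_charpoly_timeE lroots.
have g0 : g.[theta] = 0 by rewrite gE// (bigD1 i)//= subrr mul0r.
have lim1 : (g.[t] - g.[theta]) / (t - theta) @[t --> within J theta^'] --> g^`().[theta].
  apply: cvg_trans (@horner_diff_quotient_cvg _ g theta).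
  exact/cvg_app/cvg_within.
(* The factor of index [i] vanishes at [theta], so the other factors need only be continuous
   there. *)
have lim2 : (g.[t] - g.[theta]) / (t - theta) @[t --> within J theta^'] --> - D * Q.
  have : - ((lambda i t - lambda i theta) / (t - theta)) *
      \prod_(j < m | j != i) (a - lambda j t)
      @[t --> within J theta^'] --> - D * Q.
    apply: cvgM; first by apply: cvgN; exact: lder.
    apply: cvg_big => [|j _]; first exact: mul_continuous.
    by apply: cvgB; [exact: cvg_cst|exact/derivable_within_cvg/lder].
  apply: cvg_trans; apply: near_eq_cvg.
  near=> t.
  have Jt : J t by near: t; exact: near_withinT.
  rewrite g0 subr0 gE// [in RHS](bigD1 i)//= /a.
  by ring.
(* Both limits are the time derivative of f_t(a); the first is rewritten by the heat equation. *)
have : - D * Q = - ((n - m).+1%:R * Q + a * (2 * (Q * S))).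
  have := mean_charpoly_heat B m_le_n theta a; rewrite f1 f2 => <-.
  exact: (cvg_unique _ lim2 lim1).
rewrite mulNr => /oppr_inj DQ.
have -> : D = (n - m).+1%:R + 2 * a * S.
  apply: (mulIf Q0); rewrite DQ; ring.
(* Each summand is 2 a / (a - lambda_j) - 1, and the m - 1 units account for the passage from n - m
   + 1 to n. *)
have -> : \sum_(j < m | j != i) (a + lambda j theta) / (a - lambda j theta) =
    2 * a * S - m.-1%:R.
  rewrite /S mulr_sumr.
  have <- : (\sum_(j < m | j != i) 1 = m.-1)%N.
    by rewrite sum1_card cardC1 card_ord.
  rewrite natr_sum -sumrB; apply: eq_bigr => j ji.
  have : a - lambda j theta != 0 by rewrite subr_eq0 al.
  by move=> ?; field.
have m0 : (0 < m)%N by exact: leq_ltn_trans (ltn_ord i).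
have -> : (n - m).+1%:R = n%:R - m.-1%:R :> R.
  by rewrite -natrB; [congr _%:R; lia|lia].
by ring.
Unshelve. all: by end_near. Qed.

Unset Implicit Arguments.
Set Strict Implicit.
Set Printing Implicit Defensive.

Theorem mainTheorem3 (R : realType) (d : measure_display)
    (T : measurableType d) (P : probability T R)
    (m n : nat) (m_ge1 : (1 <= m)%N) (m_le_n : (m <= n)%N)
    (B : 'M[R]_(m, n)) (X : 'I_m -> 'I_n -> {RV P >-> R})
    (X_indep : mutually_independent (fun ij : 'I_m * 'I_n => X ij.1 ij.2))
    (X_ident : forall i j i' j', same_distribution P (X i j) (X i' j'))
    (X_sym : forall i j, symmetric_RV (X i j))
    (X_moments : forall i j, all_moments_finite (X i j))
    (X_var : forall i j, 'V_P[X i j] = 1%E)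
    (J : set R) (J_itv : is_interval J)
    (J_ge0 : J `<=` [set t | 0 <= t])
    (J_length : exists a b, [/\ J a, J b & a < b])
    (lambda : 'I_m -> R -> R)
    (lambda_derivable : forall i theta, J theta ->
       derivable_within J (lambda i) theta)
    (lambda_distinct : forall theta, J theta ->
       injective (fun i => lambda i theta))
    (lambda_roots : forall theta, J theta -> forall x : R,
       expected_charpoly B X theta x = (\prod_(i < m) (x - lambda i theta))%:E) :
  forall (i : 'I_m) (theta : R), J theta ->
    derive_within J (lambda i) theta =
    n%:R + \sum_(j < m | j != i)
      (lambda i theta + lambda j theta) / (lambda i theta - lambda j theta).
Proof.
(* Times in [J] are nonnegative, so the expectation is a value of [mean_charpoly] and the claim
   concerns the roots of that polynomial. *)
have mean_roots t : J t -> forall x,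
    (mean_charpoly B t).[x] = \prod_(i < m) (x - lambda i t).
  move=> Jt x; apply: EFin_inj.
  by rewrite -lambda_roots// expected_charpolyE//; exact: J_ge0.
exact: (root_velocity m_le_n J_itv J_length lambda_derivable lambda_distinct
  mean_roots).
Qed.
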